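(* Fix an integer $k\ge 2$, constants $\alpha>0$, $r>0$, $0<p<1$, and let $X$ be the number of solutions of a random instance of Model RB with parameters $(n,\alpha,r,k,p)$. Let $\tau=e^{1/r}$ and $p_{cr}=1-\frac{1}{\tau}$. If $(2k-1)\alpha>1$ and $k\ge \frac{\tau\ln\tau}{\tau-1}$, then $\lim_{n\to\infty}\Pr[X>0]=1$ if $p<p_{cr}$, and $\lim_{n\to\infty}\Pr[X>0]=0$ if $p>p_{cr}$.
   Context: Model RB with parameters $(n,\alpha,r,k,p)$, where $n$ is the number of variables, $\alpha>0$, $r>0$, $k\ge 2$ an integer and $0<p<1$: there are $n$ variables $x_1,\dots,x_n$, each with the same domain $D$ of size $d=n^{\alpha}$ (treated as an integer). A random instance is generated as follows: (1) select, independently with repetition, $t=rn\ln d$ constraints, the scope of each being a set of $k$ distinct variables chosen uniformly at random among the $n$ variables; (2) for each constraint, select uniformly at random without repetition a set of $q=p\,d^{k}$ ''incompatible'' tuples from $D^{k}$ (so the constraint's relation consists of the remaining $(1-p)d^k$ tuples). An assignment of values from $D$ to all variables is a solution if, for every constraint, the tuple of values assigned to its scope is not incompatible. Limits are taken as $n\to\infty$ with $\alpha,r,k,p$ fixed. *)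

(* Defs.v *)
From HB Require Import structures.
From mathcomp Require Import all_boot all_order all_algebra.
From mathcomp Require Import all_classical all_reals all_analysis.
Set Implicit Arguments. Unset Strict Implicit. Unset Printing Implicit Defensive.
Import Order.TTheory GRing.Theory Num.Theory.
Local Open Scope ring_scope.

Section ModelRB.
Variables (R : realType) (k : nat) (alpha r p : R).

Definition rb_d (n : nat) : nat := Num.truncn ((n%:R : R) `^ alpha).
Definition rb_t (n : nat) : nat := Num.truncn (r * n%:R * ln ((rb_d n)%:R : R)).
Definition rb_q (n : nat) : nat := Num.truncn (p * ((rb_d n)%:R : R) ^+ k).

(* a constraint: its scope (k distinct variables, listed as an injective
   k-tuple of variable indices) and its set of incompatible tuples in D^k *)
Definition rb_constraint (n : nat) : finType :=
  ({ffun 'I_k -> 'I_n} * {set {ffun 'I_k -> 'I_(rb_d n)}})%type.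

Definition rb_valid_constraint (n : nat) (c : rb_constraint n) : bool :=
  injectiveb c.1 && (#|c.2| == rb_q n).

(* an instance: t constraints, chosen independently (with repetition) *)
Definition rb_instance (n : nat) : finType :=
  {ffun 'I_(rb_t n) -> rb_constraint n}.

Definition rb_valid_instance (n : nat) (I : rb_instance n) : bool :=
  [forall i, rb_valid_constraint (I i)].

Definition rb_assignment (n : nat) : finType := {ffun 'I_n -> 'I_(rb_d n)}.

Definition rb_solution (n : nat) (I : rb_instance n) (s : rb_assignment n) : bool :=
  [forall i, [ffun j => s ((I i).1 j)] \notin (I i).2].

(* Pr[X > 0] under the uniform distribution on valid instances
   (= independent uniform choice of each scope and each incompatible set) *)
Definition rb_prob_sat (n : nat) : R :=
  (#|[set I : rb_instance n | rb_valid_instance I && [exists s, rb_solution I s]]|%:R)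
  / (#|[set I : rb_instance n | rb_valid_instance I]|%:R).

End ModelRB.

(* Main.v *)
(* Write [d] for the domain size, [D = ln d], [N = d ^ k], and let [S] be the
   number of variables on which two assignments agree.

   Above the threshold the expected number of solutions [d^n (1 - q/N)^t]
   vanishes.

   Below it, the second moment ratio [E X^2 / (E X)^2] is the mean over pairs of
   assignments of [(1 + C (sigma_S - 1/N))^t], where [sigma_S = S^_k / n^_k] and
   [C = q N / ((N - q) (N - 1))].  As [S] is binomial with mean [n/d], the bracket
   is centred; keeping the term [- 1/N] is what allows [(2k-1) alpha > 1] instead
   of [k alpha > 1].  Fix a small [eta > 0].
   - If [S/n <= d^(eta-1)], the exponent is at most [l (S - n/d)^+] where
     [(n/d) l^2 -> 0], so a second-order expansion of the exponential moments of
     [S] shows that this range contributes at most [1 + o(1)].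
   - If [S/n > d^(eta-1)], then [Pr (S = j) <= (e n / (d j))^j] and the weight is
     at most [exp (rho D j)] with [rho = - r ln (1-p) < 1], as well as at most
     [exp (c r D (j/n)^(k-1) j)] with [c = p / (1-p)]; the products are dominated
     by a geometric series of ratio [o(1)].
   The bound by [exp (rho D j)] is [1 + (e^a - 1) x^k <= e^(a x)] on [[0, 1]] for
   [a = - ln (1-p)], which is where [k >= tau ln tau / (tau - 1)] enters. *)
Require Import Defs.
From HB Require Import structures.
From mathcomp Require Import all_boot all_order all_algebra.
From mathcomp Require Import all_classical all_reals all_analysis.
From mathcomp Require Import ring lra.
Import Order.TTheory GRing.Theory Num.Theory numFieldNormedType.Exports.
Local Open Scope classical_set_scope.
Local Open Scope ring_scope.

(** * Counting single constraints satisfied by one or two assignments *)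

Definition agreement {n d : nat} (s s' : {ffun 'I_n -> 'I_d}) : {set 'I_n} :=
  [set i | s i == s' i]%SET.

(** Together with [valid], this restates the conditions of the model on one constraint with [n],
    [d], [q] free, so that the counting is purely combinatorial. *)
Definition satisfies {n d k : nat} (s : {ffun 'I_n -> 'I_d})
    (c : {ffun 'I_k -> 'I_n} * {set {ffun 'I_k -> 'I_d}}) : bool :=
  [ffun j => s (c.1 j)] \notin c.2.

Definition valid {n d k : nat} (q : nat)
    (c : {ffun 'I_k -> 'I_n} * {set {ffun 'I_k -> 'I_d}}) : bool :=
  injectiveb c.1 && (#|c.2| == q).

Lemma card_disjoint_draws (T : finType) (A : {set T}) (q : nat) :
  #|[set B : {set T} | [disjoint A & B] & #|B| == q]%SET| = 'C(#|T| - #|A|, q).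
Proof.
have -> : (#|T| - #|A|)%N = #|(~: A)%SET| by rewrite [RHS]cardsCs finset.setCK.
rewrite -cards_draws; apply: eq_card => B; rewrite !inE.
by rewrite disjoint_sym finset.disjoints_subset.
Qed.

Lemma card_pair_dep (S T : finType) (P : pred S) (Q : S -> pred T) :
  #|[set c : S * T | P c.1 && Q c.1 c.2]%SET|
    = (\sum_(a | P a) #|[set b | Q a b]%SET|)%N.
Proof.
rewrite -sum1_card (eq_bigl (fun c => P c.1 && Q c.1 c.2)); last first.
  by move=> c; rewrite !inE.
rewrite -(pair_big_dep P Q (fun _ _ => 1%N)); apply: eq_bigr => a _.
by rewrite sum1_card; apply: eq_card => b; rewrite !inE.
Qed.

Lemma card_inj_scopes (n k : nat) (A : {set 'I_n}) :
  #|[set f : {ffun 'I_k -> 'I_n} | injectiveb f & [forall j, f j \in A]]%SET|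
    = #|A| ^_ k.
Proof.
rewrite -[in RHS](card_ord k) -card_inj_ffuns_on; apply: eq_card => f.
by rewrite !inE andbC; congr andb; apply/forallP/ffun_onP.
Qed.

Lemma card_valid (n d k q : nat) :
  #|[set c | valid (n := n) (d := d) (k := k) q c]%SET| = (n ^_ k * 'C(d ^ k, q))%N.
Proof.
rewrite (card_pair_dep _ _ (fun f : {ffun 'I_k -> 'I_n} => injectiveb f)
  (fun _ (b : {set {ffun 'I_k -> 'I_d}}) => #|b| == q)).
by rewrite sum_nat_cond_const card_inj_ffuns !card_ord card_draws card_ffun !card_ord.
Qed.

(** Whatever the scope, [s] induces exactly one tuple on it, and the incompatible set has to avoid
    that tuple. *)
Lemma card_sat1 (n d k q : nat) (s : {ffun 'I_n -> 'I_d}) :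
  #|[set c | valid (k := k) q c & satisfies s c]%SET|
    = (n ^_ k * 'C((d ^ k).-1, q))%N.
Proof.
pose Q (f : {ffun 'I_k -> 'I_n}) (b : {set {ffun 'I_k -> 'I_d}}) :=
  [disjoint [set [ffun j => s (f j)]]%SET & b] && (#|b| == q).
transitivity #|[set c : {ffun 'I_k -> 'I_n} * {set {ffun 'I_k -> 'I_d}} |
    injectiveb c.1 && Q c.1 c.2]%SET|.
  by apply: eq_card => c; rewrite !inE /valid /satisfies /Q disjoints1 andbAC andbA.
rewrite (card_pair_dep _ _ (fun f : {ffun 'I_k -> 'I_n} => injectiveb f) Q).
rewrite (eq_bigr (fun=> 'C((d ^ k).-1, q))) => [|f _].
  by rewrite sum_nat_cond_const card_inj_ffuns !card_ord.
by rewrite /Q card_disjoint_draws cards1 card_ffun !card_ord subn1.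
Qed.

(** The tuples induced by [s] and [s'] coincide exactly when the scope lies inside the agreement
    set. Such scopes leave one tuple to avoid, all the others leave two. *)
Lemma card_sat2 (n d k q : nat) (s s' : {ffun 'I_n -> 'I_d}) :
  #|[set c | [&& valid (k := k) q c, satisfies s c & satisfies s' c]]%SET|
    = (#|agreement s s'| ^_ k * 'C((d ^ k).-1, q)
       + (n ^_ k - #|agreement s s'| ^_ k) * 'C((d ^ k).-2, q))%N.
Proof.
pose Q (f : {ffun 'I_k -> 'I_n}) (b : {set {ffun 'I_k -> 'I_d}}) :=
  [disjoint [set [ffun j => s (f j)]; [ffun j => s' (f j)]]%SET & b] && (#|b| == q).
transitivity #|[set c : {ffun 'I_k -> 'I_n} * {set {ffun 'I_k -> 'I_d}} |
    injectiveb c.1 && Q c.1 c.2]%SET|.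
  apply: eq_card => c; rewrite !inE /valid /satisfies /Q.
  rewrite finset.disjoints_subset finset.subUset !finset.sub1set !inE.
  by rewrite -!andbA; congr andb; rewrite andbC -!andbA.
pose G (f : {ffun 'I_k -> 'I_n}) := [forall j, f j \in agreement s s'].
have eqG (f : {ffun 'I_k -> 'I_n}) : ([ffun j => s (f j)] == [ffun j => s' (f j)]) = G f.
  apply/eqP/forallP => [/ffunP e j|e]; first by move: (e j); rewrite !ffunE inE => ->.
  by apply/ffunP => j; rewrite !ffunE; move: (e j); rewrite inE => /eqP.
rewrite (card_pair_dep _ _ (fun f : {ffun 'I_k -> 'I_n} => injectiveb f) Q).
rewrite (bigID G) /=; congr addn.
  rewrite (eq_bigr (fun=> 'C((d ^ k).-1, q))) => [|f /andP[_ Gf]].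
    by rewrite sum_nat_cond_const -card_inj_scopes.
  by rewrite /Q card_disjoint_draws cards2 eqG Gf card_ffun !card_ord subn1.
rewrite (eq_bigr (fun=> 'C((d ^ k).-2, q))) => [|f /andP[_ nGf]].
  rewrite sum_nat_cond_const -card_inj_scopes; congr muln.
  have <- : #|[set f : {ffun 'I_k -> 'I_n} | injectiveb f]%SET| = n ^_ k.
    by rewrite card_inj_ffuns !card_ord.
  rewrite -cardsDS; last by apply/fintype.subsetP => f; rewrite !inE => /andP[].
  by apply: eq_card => f; rewrite !inE /G; case: injectiveb; rewrite ?andbT.
by rewrite /Q card_disjoint_draws cards2 eqG (negbTE nGf) card_ffun !card_ord subn2.
Qed.

Lemma card_ffun_forall (t : nat) (T : finType) (P : pred T) :
  #|[set f : {ffun 'I_t -> T} | [forall i, P (f i)]]%SET| = (#|[set x | P x]%SET| ^ t)%N.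
Proof.
rewrite -[in RHS](card_ord t) -card_ffun_on; apply: eq_card => f; rewrite inE.
by apply/forallP/ffun_onP => h i; move: (h i); rewrite inE.
Qed.

(** * Instance counts and the first two moments as integer sums *)

Section Moments.
Context {R : realType} (k : nat) (alpha r p : R) (n : nat).
Let d := rb_d alpha n.
Let q := rb_q k alpha p n.
Let t := rb_t alpha r n.
Let N := (d ^ k)%N.

Lemma card_valid_instance :
  #|[set I : rb_instance k alpha r n | rb_valid_instance p I]%SET|
    = ((n ^_ k * 'C(N, q)) ^ t)%N.
Proof.
rewrite -(card_valid n d k q) -card_ffun_forall; apply: eq_card => I; rewrite !inE.
by apply/forallP/forallP => h i; move: (h i).
Qed.

Lemma card_sat1_instance (s : rb_assignment alpha n) :
  #|[set I : rb_instance k alpha r n | rb_valid_instance p I && rb_solution I s]%SET|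
    = ((n ^_ k * 'C(N.-1, q)) ^ t)%N.
Proof.
rewrite -(card_sat1 n d k q s) -card_ffun_forall; apply: eq_card => I; rewrite !inE.
apply/andP/forallP => [[/forallP v /forallP h] i|h].
  by apply/andP; split; [apply: v | apply: h].
by split; apply/forallP => i; case/andP: (h i).
Qed.

Lemma card_sat2_instance (s s' : rb_assignment alpha n) :
  #|[set I : rb_instance k alpha r n |
      [&& rb_valid_instance p I, rb_solution I s & rb_solution I s']]%SET|
    = ((#|agreement s s'| ^_ k * 'C(N.-1, q)
       + (n ^_ k - #|agreement s s'| ^_ k) * 'C(N.-2, q)) ^ t)%N.
Proof.
rewrite -(card_sat2 n d k q s s') -card_ffun_forall; apply: eq_card => I; rewrite !inE.
apply/and3P/forallP => [[/forallP v /forallP h /forallP h'] i|h].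
  by apply/and3P; split; [apply: v | apply: h | apply: h'].
by split; apply/forallP => i; case/and3P: (h i).
Qed.

Definition num_solutions (I : rb_instance k alpha r n) : nat :=
  #|[set s | rb_solution I s]%SET|.

Lemma sum_num_solutions :
  (\sum_(I : rb_instance k alpha r n | rb_valid_instance p I) num_solutions I)%N
    = (d ^ n * (n ^_ k * 'C(N.-1, q)) ^ t)%N.
Proof.
transitivity (\sum_(s : rb_assignment alpha n) (n ^_ k * 'C(N.-1, q)) ^ t)%N; last first.
  by rewrite sum_nat_const card_ffun !card_ord.
under eq_bigr => I _ do rewrite /num_solutions -sum1_card big_mkcond /=.
rewrite exchange_big /=; apply: eq_bigr => s _.
rewrite -(card_sat1_instance s) -sum1_card -big_mkcondr /=.
by apply: eq_bigl => I; rewrite !inE.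
Qed.

Lemma sum_num_solutions_sqr :
  (\sum_(I : rb_instance k alpha r n | rb_valid_instance p I) num_solutions I ^ 2)%N
    = (\sum_(s : rb_assignment alpha n) \sum_(s' : rb_assignment alpha n)
        (#|agreement s s'| ^_ k * 'C(N.-1, q)
         + (n ^_ k - #|agreement s s'| ^_ k) * 'C(N.-2, q)) ^ t)%N.
Proof.
transitivity (\sum_(I : rb_instance k alpha r n | rb_valid_instance p I)
    \sum_(s : rb_assignment alpha n) \sum_(s' : rb_assignment alpha n)
      (rb_solution I s && rb_solution I s' : nat))%N.
  apply: eq_bigr => I _.
  have -> : num_solutions I = (\sum_(s : rb_assignment alpha n) (rb_solution I s : nat))%N.
    by rewrite /num_solutions -sum1dep_card big_mkcond.
  rewrite -mulnn big_distrl /=; apply: eq_bigr => s _; rewrite big_distrr /=.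
  by apply: eq_bigr => s' _; rewrite mulnb.
rewrite exchange_big /=; apply: eq_bigr => s _.
rewrite exchange_big /=; apply: eq_bigr => s' _.
rewrite -card_sat2_instance -sum1dep_card big_mkcondr /=.
by apply: eq_bigr => I _; case: ifP.
Qed.

End Moments.

(** * First and second moment inequalities *)

Lemma first_moment (R : realType) (T : finType) (P : pred T) (X : T -> nat) :
  #|[set x | P x && (0 < X x)%N]%SET|%:R / #|[set x | P x]%SET|%:R
    <= (\sum_(x | P x) X x)%:R / #|[set x | P x]%SET|%:R :> R.
Proof.
rewrite ler_wpM2r ?invr_ge0// ler_nat -sum1dep_card big_mkcondr /=.
by apply: leq_sum => x _; case: ifP.
Qed.

(* Chebyshev: with [mu] the mean of [X], [1 <= (X / mu - 1) ^ 2] where [X = 0]. *)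
Lemma second_moment (R : realType) (T : finType) (P : pred T) (X : T -> nat) :
  (0 < \sum_(x | P x) X x)%N ->
  2 - #|[set x | P x]%SET|%:R * (\sum_(x | P x) X x ^ 2)%:R
        / (\sum_(x | P x) X x)%:R ^+ 2
    <= #|[set x | P x && (0 < X x)%N]%SET|%:R / #|[set x | P x]%SET|%:R :> R.
Proof.
set A := #|[set x | P x && _]%SET|; set B := #|[set x | P x]%SET|.
set M := (\sum_(x | P x) X x)%N; set Q := (\sum_(x | P x) X x ^ 2)%N => M0.
have B0 : (0 < B)%N.
  rewrite card_gt0; apply: contraTneq M0 => /finset.setP B0.
  by rewrite -leqNgt /M big_pred0 // => x; move: (B0 x); rewrite !inE => ->.
have Mr : M%:R != 0 :> R by rewrite pnatr_eq0 -lt0n.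
have Br : B%:R != 0 :> R by rewrite pnatr_eq0 -lt0n.
pose m : R := M%:R / B%:R.
have mr : m != 0 by rewrite mulf_neq0 ?invr_eq0.
have : \sum_(x | P x) (1 - (0 < X x)%N%:R) <= \sum_(x | P x) ((X x)%:R / m - 1) ^+ 2 :> R.
  apply: ler_sum => x _; case: (posnP (X x)) => [->|_].
    by rewrite mul0r sub0r sqrrN expr1n subr0.
  by rewrite subrr sqr_ge0.
rewrite sumrB sumr_const -natr_sum.
have -> : (\sum_(x | P x) (0 < X x) = A)%N.
  by rewrite /A -sum1dep_card big_mkcondr /=; apply: eq_bigr => x _; case: ifP.
have -> : #|[pred x | P x]| = B by rewrite /B cardsE.
have -> : \sum_(x | P x) ((X x)%:R / m - 1) ^+ 2 = Q%:R / m ^+ 2 - B%:R :> R.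
  rewrite (eq_bigr (fun x => (X x ^ 2)%:R / m ^+ 2 - 2 / m * (X x)%:R + 1)); last first.
    by move=> x _; rewrite natrX; field.
  rewrite big_split sumrB /= -mulr_suml -mulr_sumr -!natr_sum sumr_const.
  have -> : #|[pred x | P x]| = B by rewrite /B cardsE.
  rewrite -/M -/Q.
  have -> : 2 / m * M%:R = 2 * B%:R by rewrite /m; field; rewrite ?Mr ?Br.
  by ring.
move=> h; rewrite ler_pdivlMr ?ltr0n// mulrBl.
have e : B%:R * Q%:R / M%:R ^+ 2 * B%:R = Q%:R / m ^+ 2 :> R.
  by rewrite /m; field; rewrite ?Mr ?Br.
by rewrite e; lra.
Qed.

(** * The normalised weight of a pair of assignments *)

Lemma natr_bin_pred (R : realType) (m q : nat) : (q <= m)%N -> (0 < m)%N ->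
  'C(m.-1, q)%:R = (1 - q%:R / m%:R) * 'C(m, q)%:R :> R.
Proof.
move=> qm m0; have := mul_bin_down m q => /(congr1 (fun x => x%:R : R)).
rewrite !natrM natrB// => h.
have N0 : m%:R != 0 :> R by rewrite pnatr_eq0 -lt0n.
by apply: (mulfI N0); rewrite h; field.
Qed.

Lemma leq_ffact2r (k j n : nat) : (j <= n)%N -> (j ^_ k <= n ^_ k)%N.
Proof. by move=> jn; rewrite !ffact_prod; apply: leq_prod => i _; rewrite leq_sub2r. Qed.

(** This is [j^_k / n^_k <= (j/n)^k], cleared of denominators; it holds factor by factor since
    [(j - i) n <= (n - i) j]. *)
Lemma ffact_ratio_le (k j n : nat) : (j <= n)%N -> (j ^_ k * n ^ k <= n ^_ k * j ^ k)%N.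
Proof.
move=> jn; rewrite !ffact_prod -[X in (_ * _ ^ X)%N](card_ord k).
rewrite -[X in (_ <= _ * _ ^ X)%N](card_ord k).
rewrite -!prod_nat_const -!big_split /=; apply: leq_prod => i _.
by rewrite !mulnBl leq_sub // ?[(n * j)%N]mulnC // leq_mul2l jn orbT.
Qed.

(** With [a] and [b] the numbers of scopes inside the agreement set and in total, the left side is
    Pr(both satisfied) / Pr(one satisfied)^2 for one constraint. All binomials reduce to multiples
    of ['C(M, q)], which cancels. *)
Lemma pair_weight_identity (R : realType) (M q a b : nat) :
  (q < M)%N -> (1 < M)%N -> (0 < b)%N -> (a <= b)%N ->
  (b * 'C(M, q))%:R / (b * 'C(M.-1, q))%:R ^+ 2
    * (a * 'C(M.-1, q) + (b - a) * 'C(M.-2, q))%:R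
  = 1 + q%:R * M%:R / ((M%:R - q%:R) * (M%:R - 1)) * (a%:R / b%:R - M%:R^-1) :> R.
Proof.
case: M => [|[|M]]// qM _ b0 ab; rewrite /= natrD !natrM natrB//.
have := natr_bin_pred R M.+1 q qM isT; rewrite /= => ->.
have := natr_bin_pred R M.+2 q (ltnW qM) isT; rewrite /= => ->.
have : 'C(M.+2, q)%:R != 0 :> R by rewrite pnatr_eq0 -lt0n bin_gt0 ltnW.
have br : b%:R != 0 :> R by rewrite pnatr_eq0 -lt0n.
have qr : M.+2%:R - q%:R != 0 :> R by rewrite -natrB ?(ltnW qM)// pnatr_eq0 -lt0n subn_gt0.
have Nr : M.+2%:R != 0 :> R by rewrite pnatr_eq0.
have -> : M.+1%:R = M.+2%:R - 1 :> R by rewrite -[M.+2]addn1 natrD addrK.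
have N1r : M.+2%:R - 1 != 0 :> R by rewrite -[M.+2]addn1 natrD addrK pnatr_eq0.
move: (_%:R) (q%:R) (a%:R) (b%:R) (M.+2%:R) br qr Nr N1r => c x y z u z0 ux u0 u1 c0.
by field; rewrite z0 ux u0 u1 c0.
Qed.

Section MomentBounds.
Context {R : realType} (k : nat) (alpha r p : R) (n : nat).
Let d := rb_d alpha n.
Let q := rb_q k alpha p n.
Let t := rb_t alpha r n.
Let N : R := d%:R ^+ k.

Lemma rb_prob_satE : rb_prob_sat k alpha r p n =
  #|[set I : rb_instance k alpha r n |
      rb_valid_instance p I && (0 < num_solutions k alpha r n I)%N]%SET|%:R
  / #|[set I : rb_instance k alpha r n | rb_valid_instance p I]%SET|%:R :> R.
Proof.
rewrite /rb_prob_sat; congr (_%:R / _); apply: eq_card => I; rewrite !inE; congr andb.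
by rewrite card_gt0; apply/existsP/finset.set0Pn => -[s h]; exists s; rewrite inE in h *.
Qed.

Lemma natN : (d ^ k)%:R = N. Proof. by rewrite natrX. Qed.

Lemma rb_prob_sat_le : (k <= n)%N -> (0 < d)%N -> (q <= d ^ k)%N ->
  rb_prob_sat k alpha r p n <= d%:R ^+ n * (1 - q%:R / N) ^+ t :> R.
Proof.
move=> kn d0 qN; rewrite rb_prob_satE; apply: le_trans (first_moment _ _ _ _) _.
rewrite sum_num_solutions card_valid_instance -/d -/q -/t.
have dk0 : (0 < d ^ k)%N by rewrite expn_gt0 d0.
rewrite !(natrM, natrX) natr_bin_pred ?natN -/N// !exprMn.
have V0 : (n ^_ k)%:R ^+ t != 0 :> R by rewrite expf_neq0 // pnatr_eq0 -lt0n ffact_gt0.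
have C0 : 'C(d ^ k, q)%:R ^+ t != 0 :> R by rewrite expf_neq0 // pnatr_eq0 -lt0n bin_gt0.
move: V0 C0; move: (_ ^+ t) ('C(_, _)%:R ^+ t) (_ ^+ t) (_ ^+ n) => a b c e a0 b0.
rewrite le_eqVlt; apply/orP; left; apply/eqP. by field; rewrite a0 b0.
Qed.

Definition pair_weight (j : nat) : R :=
  1 + q%:R * N / ((N - q%:R) * (N - 1)) * ((j ^_ k)%:R / (n ^_ k)%:R - N^-1).

Lemma rb_prob_sat_ge : (0 < k <= n)%N -> (1 < d)%N -> (q < d ^ k)%N ->
  2 - (\sum_(s : rb_assignment alpha n) \sum_(s' : rb_assignment alpha n)
         pair_weight #|agreement s s'| ^+ t) / (d%:R ^+ n) ^+ 2
    <= rb_prob_sat k alpha r p n.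
Proof.
move=> /andP[k0 kn] d1 qN; rewrite rb_prob_satE.
have N1 : (1 < d ^ k)%N by rewrite -(exp1n k) ltn_exp2r.
have W0 : (0 < n ^_ k * 'C((d ^ k).-1, q))%N.
  by rewrite muln_gt0 ffact_gt0 kn bin_gt0 -ltnS prednK // ltnW.
apply: le_trans (second_moment R _ _ _ _); last first.
  rewrite sum_num_solutions muln_gt0 !expn_gt0 -/d -/q (ltnW d1) /=.
  by rewrite W0.
rewrite lerD2l lerN2 sum_num_solutions sum_num_solutions_sqr card_valid_instance.
rewrite -/d -/q -/t.
have W0r : (n ^_ k * 'C((d ^ k).-1, q))%:R != 0 :> R by rewrite pnatr_eq0 -lt0n.
have d0r : d%:R != 0 :> R by rewrite pnatr_eq0 -lt0n ltnW.
(* The constraints are independent, so the normalisation is itself a [t]-th power and can be merged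
   with the count of each pair. *)
have -> : forall S, ((n ^_ k * 'C(d ^ k, q)) ^ t)%:R * S /
    (d ^ n * (n ^_ k * 'C((d ^ k).-1, q)) ^ t)%:R ^+ 2
  = (((n ^_ k * 'C(d ^ k, q))%:R / (n ^_ k * 'C((d ^ k).-1, q))%:R ^+ 2) ^+ t * S)
     / (d%:R ^+ n) ^+ 2 :> R.
  move=> S; rewrite natrM !natrX exprMn expr_div_n -[(_ ^+ t) ^+ 2]exprM.
  rewrite -[(_ ^+ 2) ^+ t]exprM (mulnC 2 t).
  have := expf_neq0 (t * 2) W0r; have := expf_neq0 2 (expf_neq0 n d0r).
  move: (_ ^+ (t * 2)) ((_ ^+ n) ^+ 2) (_ ^+ t) => a b c b0 a0.
  by field; rewrite a0 b0.
rewrite ler_wpM2r ?invr_ge0 ?exprn_ge0// natr_sum mulr_sumr; apply: ler_sum => s _.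
rewrite natr_sum mulr_sumr; apply: ler_sum => s' _.
rewrite natrX -exprMn le_eqVlt; apply/orP; left; apply/eqP; congr (_ ^+ _).
have jn : (#|agreement s s'| ^_ k <= n ^_ k)%N.
  by apply: leq_ffact2r; rewrite -[X in (_ <= X)%N](card_ord n) max_card.
by rewrite pair_weight_identity ?ffact_gt0// natN.
Qed.

End MomentBounds.

(** * Inequalities for the exponential *)

(** From [e^z (1 - z) <= 1] and [(1 + z + 2 z^2) (1 - z) = 1 + z^2 (1 - 2 z) >= 1]. *)
Lemma expR_le_quadratic (R : realType) (z : R) :
  0 <= z -> z <= 2^-1 -> expR z <= 1 + z + 2 * z ^+ 2.
Proof.
move=> z0 z1.
have h : expR z * (1 - z) <= 1.
  by rewrite mulrC -ler_pdivlMr ?expR_gt0// div1r -expRN expR_ge1Dx.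
have z1' : 0 < 1 - z by lra.
rewrite -(ler_pM2r z1'); apply: le_trans h _.
have := sqr_ge0 z; have : 0 <= z ^+ 2 * (1 - 2 * z) by apply: mulr_ge0; [exact: sqr_ge0|lra].
by nra.
Qed.

(** Bernoulli's inequality for [(1 + w)^d] with [w = e^z - 1 > -1]. *)
Lemma bernoulli_expR (R : realType) (d : nat) (z : R) :
  1 + d%:R * (expR z - 1) <= expR (d%:R * z).
Proof.
elim: d => [|d IH]; first by rewrite !mul0r addr0 expR0.
have -> : d.+1%:R = d%:R + 1 :> R by rewrite -addn1 natrD.
have -> : expR ((d%:R + 1) * z) = expR (d%:R * z) * expR z by rewrite mulrDl mul1r expRD.
apply: le_trans (ler_wpM2r (expR_ge0 z) IH).
by have := mulr_ge0 (ler0n R d) (sqr_ge0 (expR z - 1)); nra.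
Qed.

(* [1 - e^(-y)] is concave and vanishes at [0]. *)
Lemma le_mulr_1subexpRN (R : realType) (b K y : R) :
  0 < b -> b <= K * (1 - expR (- b)) -> 0 <= y -> y <= b -> y <= K * (1 - expR (- y)).
Proof.
move=> b0 bK y0 yb.
pose s := y / b.
have s0 : 0 <= s by rewrite divr_ge0 // ltW.
have s1 : s <= 1 by rewrite ler_pdivrMr // mul1r.
have ys : y = s * b by rewrite /s divfK // gt_eqF.
have K0 : 0 <= K.
  rewrite leNgt; apply/negP => K0.
  have : expR (- b) <= 1 by rewrite -expR0 ler_expR; lra.
  by nra.
have v0 := expR_gt0 (- y).
(* [h1] and [h2] are the tangent line of the exponential at [- y], evaluated at [0] and at [- b].
   With weights [1 - s] and [s] the linear terms cancel, because [y = s b]. *)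
have h1 : expR (- y) * (1 + y) <= 1.
  have := expR_ge1Dx y; rewrite expRN -(ler_pM2l v0) expRN mulVf //.
  by rewrite gt_eqF ?expR_gt0.
have h2 : expR (- y) * (1 + (y - b)) <= expR (- b).
  have := expR_ge1Dx (y - b); rewrite -(ler_pM2l v0) -expRD.
  by have -> : - y + (y - b) = - b by ring.
have : expR (- y) <= 1 - s * (1 - expR (- b)).
  have e : expR (- y) = (1 - s) * (expR (- y) * (1 + y)) + s * (expR (- y) * (1 + (y - b))).
    by rewrite ys; ring.
  have : (1 - s) * (expR (- y) * (1 + y)) <= (1 - s) * 1 by rewrite ler_wpM2l ?subr_ge0.
  have : s * (expR (- y) * (1 + (y - b))) <= s * expR (- b) by rewrite ler_wpM2l.
  by move: e; set A := (1 - s) * (_ * _); set B := s * (_ * _); lra.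
move=> h; have : K * (s * (1 - expR (- b))) <= K * (1 - expR (- y)).
  by rewrite ler_wpM2l //; lra.
apply: le_trans; rewrite ys mulrCA.
by rewrite ler_wpM2l.
Qed.

(* [ln (e^(a s) - 1) - k ln s] is nonincreasing in [s]: the hypothesis at [y = a s]
   says that its derivative is nonpositive. *)
Lemma expR_pow_le (R : realType) (k : nat) (a x : R) : (0 < k)%N -> 0 < a ->
  (forall y, 0 <= y -> y <= a -> y <= k%:R * (1 - expR (- y))) ->
  0 <= x -> x <= 1 -> 1 + (expR a - 1) * x ^+ k <= expR (a * x).
Proof.
move=> k0 a0 H; rewrite le_eqVlt => /predU1P[<- _|x0 x1].
  by rewrite mulr0 expR0 expr0n gtn_eqF // mulr0 addr0.
have E1 s : 0 < s -> 0 < expR (a * s) - 1.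
  by move=> s0; rewrite subr_gt0 -expR0 ltr_expR mulr_gt0.
pose f (s : R) := ln (expR (a * s) - 1) - k%:R * ln s.
have df (s : R) : 0 < s ->
    is_derive s (1 : R) f (a * expR (a * s) / (expR (a * s) - 1) - k%:R / s).
  move=> s0.
  have D1 := is_deriveZ a (is_derive_id s (1 : R)).
  have D2 := is_deriveB (is_derive1_comp (is_derive_expR _) D1) (is_derive_cst (1 : R) s (1 : R)).
  have D3 := @is_derive1_comp _ (@ln R) (expR \o a \*: id - cst (1 : R)) s _ _
    (is_derive1_ln (E1 _ s0)) D2.
  have D4 := is_deriveB D3 (is_deriveZ k%:R (is_derive1_ln s0)).
  apply: (is_derive_eq D4).
  rewrite subr0 /GRing.scale /= mulr1; ring.
have : f 1 <= f x.
  apply: (@ler0_derive1_nincr R f x 1) => //.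
  - move=> s; rewrite in_itv /= => /andP[xs _].
    have s0 := lt_trans x0 xs.
    by have := df s s0 => -[].
  - move=> s; rewrite in_itv /= => /andP[xs s1].
    have s0 := lt_trans x0 xs.
    have D := df s s0.
    rewrite derive1E derive_val.
    have as0 : 0 <= a * s by rewrite mulr_ge0 // ltW.
    have asa : a * s <= a by rewrite ger_pMr // ltW.
    (* Multiplied by [e^(a s)], the hypothesis reads [a s e^(a s) <= k (e^(a s) - 1)], which is the
       sign of the derivative. *)
    have := H _ as0 asa; rewrite -(ler_pM2r (expR_gt0 (a * s))).
    rewrite -[leRHS]mulrA [(1 - _) * _]mulrBl mul1r.
    rewrite expRN mulVf ?gt_eqF ?expR_gt0// => h.
    by rewrite subr_le0 ler_pdivrMr ?E1// [leRHS]mulrAC ler_pdivlMr // mulrAC.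
  - apply: derivable_within_continuous => s; rewrite in_itv /= => /andP[xs _].
    by have := df s (lt_le_trans x0 xs) => -[].
rewrite /f mulr1 ln1 mulr0 subr0 => h.
have e1 : 0 < expR a - 1 by have := E1 1 ltr01; rewrite mulr1.
rewrite -lerBrDl -ler_ln ?posrE ?mulr_gt0 ?exprn_gt0 ?E1//.
by rewrite lnM ?posrE ?exprn_gt0// lnXn// -mulr_natl -lerBrDr.
Qed.

(** * Distribution of the number of agreements *)

(** Generating function of the agreement count: the coordinates are independent, and in each one
    value contributes [x] and the other [d - 1] values contribute [1]. *)
Lemma sum_exp_agreement (R : realType) (n d : nat) (s : {ffun 'I_n -> 'I_d}) (x : R) :
  \sum_(s' : {ffun 'I_n -> 'I_d}) x ^+ #|agreement s s'| = (d%:R - 1 + x) ^+ n.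
Proof.
transitivity (\sum_(s' : {ffun 'I_n -> 'I_d}) \prod_i (if s i == s' i then x else 1)).
  apply: eq_bigr => s' _; rewrite -big_mkcond /= prodr_const; congr (_ ^+ _).
  by apply: eq_card => i; rewrite !inE.
rewrite -(bigA_distr_bigA (fun i v => if s i == v then x else 1)) /=.
rewrite (eq_bigr (fun=> d%:R - 1 + x)) ?prodr_const ?card_ord // => i _.
rewrite (bigD1 (s i)) //= eqxx (eq_bigr (fun=> 1)); last first.
  by move=> v; rewrite eq_sym => /negbTE ->.
rewrite sumr_const cardC1 card_ord addrC -subn1 natrB ?(leq_ltn_trans _ (ltn_ord (s i)))//.
Qed.

(** Chernoff bound: Markov's inequality for [x ^+ S], then [d - 1 + x <= d e^(x/d)]. *)
Lemma card_agreement_le (R : realType) (n d j : nat) (s : {ffun 'I_n -> 'I_d}) :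
  (0 < d)%N -> (0 < j)%N -> (0 < n)%N ->
  #|[set s' | #|agreement s s'| == j]%SET|%:R
    <= d%:R ^+ n * (expR 1 * (n%:R / d%:R) / j%:R) ^+ j :> R.
Proof.
move=> d0 j0 n0.
have d0r : 0 < d%:R :> R by rewrite ltr0n.
have j0r : 0 < j%:R :> R by rewrite ltr0n.
have n0r : 0 < n%:R :> R by rewrite ltr0n.
(* This [x] minimises [e^(n x / d) / x^j], and makes [e^(n x / d)] equal to [e^j]. *)
pose x : R := j%:R * d%:R / n%:R.
have x0 : 0 < x by rewrite divr_gt0 ?mulr_gt0.
have h1 : #|[set s' | #|agreement s s'| == j]%SET|%:R * x ^+ j <= (d%:R - 1 + x) ^+ n.
  rewrite -(sum_exp_agreement R n d s x) mulr_natl -sumr_const.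
  rewrite [leRHS](bigID (fun s' => #|agreement s s'| == j)) /= -[leLHS]addr0 lerD //.
    rewrite le_eqVlt; apply/orP; left; apply/eqP.
    by apply: eq_big => [s'|s']; rewrite ?inE // => /eqP ->.
  by apply: sumr_ge0 => s' _; rewrite exprn_ge0 // ltW.
have h2 : (d%:R - 1 + x) ^+ n <= d%:R ^+ n * expR 1 ^+ j.
  have -> : expR 1 ^+ j = expR (x / d%:R) ^+ n :> R.
    rewrite -!expRM_natl; congr expR; rewrite /x mulr1; field.
    by rewrite !gt_eqF.
  rewrite -exprMn lerXn2r ?nnegrE ?mulr_ge0 ?expR_ge0 ?ler0n//.
    have : 1 <= d%:R :> R by rewrite ler1n.
    by lra.
  apply: (@le_trans _ _ (d%:R * (1 + x / d%:R))); last by rewrite ler_wpM2l ?expR_ge1Dx// ltW.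
  by rewrite mulrDr mulr1 mulrCA divff ?gt_eqF// mulr1; lra.
have e : expR 1 * (n%:R / d%:R) / j%:R = expR 1 / x :> R.
  by rewrite /x; field; rewrite !gt_eqF.
rewrite e expr_div_n mulrA ler_pdivlMr ?exprn_gt0//.
exact: le_trans h1 h2.
Qed.

Lemma sum_geometric_le (R : realType) (y : R) (n : nat) :
  0 <= y -> y <= 2^-1 -> \sum_(j < n.+1 | (0 < j)%N) y ^+ j <= 2 * y.
Proof.
move=> y0 y1; rewrite big_mkcond big_ord_recl /= add0r.
(* The induction needs the sharper bound [2 y - 2 y^(n+1)]; its step is [2 y <= 1]. *)
apply: (@le_trans _ _ (2 * y - 2 * y ^+ n.+1)); last by rewrite gerBl mulr_ge0 // exprn_ge0.
elim: n => [|n IH]; first by rewrite big_ord0 expr1 subrr.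
rewrite big_ord_recr /= [y ^+ n.+2]exprS; apply: le_trans (lerD IH (lexx _)) _.
by rewrite /bump /=; have := exprn_ge0 n.+1 y0; nra.
Qed.

(* The two ranges of [S]: off [J], [e^(u^+) <= 1 + e + (e^u - 1)^2 / (4 e)] with
   [u = l (S - m)]; on [J], the bound on [Pr (S = j)] and a geometric series. *)
Lemma sum_agreement_le (R : realType) (n d : nat) (s : {ffun 'I_n -> 'I_d})
    (F : nat -> R) (J : pred nat) (l y e : R) :
  let m : R := n%:R / d%:R in
  (0 < d)%N -> (0 < n)%N -> 0 <= l -> l <= 4^-1 -> 0 <= y -> y <= 2^-1 -> 0 < e ->
  (forall j, (j <= n)%N -> ~~ J j -> F j <= expR (Num.max 0 (l * (j%:R - m)))) ->
  (forall j, (j <= n)%N -> J j ->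
     (0 < j)%N /\ F j * (expR 1 * m / j%:R) ^+ j <= y ^+ j) ->
  (forall j, (j <= n)%N -> 0 <= F j) ->
  \sum_(s' : {ffun 'I_n -> 'I_d}) F #|agreement s s'|
    <= d%:R ^+ n * (1 + e + (expR (8 * m * l ^+ 2) - 1) / (4 * e) + 2 * y).
Proof.
move=> m d0 n0 l0 l1 y0 y1 e0 FA FB F0.
have d0r : 0 < d%:R :> R by rewrite ltr0n.
have agn (s' : {ffun 'I_n -> 'I_d}) : (#|agreement s s'| <= n)%N.
  by rewrite -[X in (_ <= X)%N](card_ord n) max_card.
rewrite (bigID (fun s' => J #|agreement s s'|)) /= addrC mulrDr; apply: lerD.
  pose u (s' : {ffun 'I_n -> 'I_d}) := l * (#|agreement s s'|%:R - m).
  pose A (s' : {ffun 'I_n -> 'I_d}) := 1 + e + (expR (u s') - 1) ^+ 2 / (4 * e).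
  have A0 s' : 0 <= A s'.
    by rewrite /A addr_ge0 // ?addr_ge0 ?divr_ge0 ?sqr_ge0 ?mulr_ge0 // ltW.
  (* [A] is nonnegative, so the sum may be extended to all [s'], where the exponential moments are
     explicit. *)
  apply: (@le_trans _ _ (\sum_s' A s')).
    rewrite [leRHS](bigID (fun s' => J #|agreement s s'|)) /= -[leLHS]add0r lerD //.
      by apply: sumr_ge0.
    apply: ler_sum => s' nJ; apply: le_trans (FA _ (agn s') nJ) _.
    rewrite -/(u s') /A; set w := expR (u s').
    apply: (@le_trans _ _ (1 + `|w - 1|)).
      case: (leP 0 (u s')) => _; last by rewrite expR0 lerDl.
      by rewrite -/w -lerBlDl ler_norm.
    (* The arithmetic-geometric inequality [|w - 1| <= e + (w - 1)^2 / (4 e)]. *)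
    rewrite -addrA lerD2l -lerBlDl ler_pdivlMr ?mulr_gt0// -(real_normK (num_real (w - 1))).
    by have := sqr_ge0 (`|w - 1| - 2 * e); nra.
  have S (z : R) : \sum_s' expR (z * (#|agreement s s'|%:R - m))
      = (expR (- z / d%:R) * (d%:R - 1 + expR z)) ^+ n.
    rewrite exprMn -(sum_exp_agreement R n d s) mulr_sumr; apply: eq_bigr => s' _.
    rewrite -!expRM_natl -expRD; congr expR; rewrite /m; field.
    by rewrite gt_eqF.
  have c : \sum_(s' : {ffun 'I_n -> 'I_d}) 1 = d%:R ^+ n :> R.
    by rewrite sumr_const card_ffun !card_ord natrX.
  (* Since [u] is centred, the mean of [e^u] is at least [1]; per coordinate this is Bernoulli's
     inequality at [l / d]. *)
  have S1 : d%:R ^+ n <= \sum_s' expR (u s').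
    rewrite /u S lerXn2r ?nnegrE ?ler0n// ?mulr_ge0 ?expR_ge0//.
      have : 1 <= d%:R :> R by rewrite ler1n.
    by have := expR_ge0 l; lra.
    rewrite mulNr expRN mulrC ler_pdivlMr ?expR_gt0//.
    have := bernoulli_expR R d (l / d%:R); rewrite mulrCA divff ?gt_eqF// mulr1.
    by set w := expR (l / _); lra.
  have S2 : \sum_s' expR (2 * u s') <= d%:R ^+ n * expR (8 * m * l ^+ 2).
    have -> : expR (8 * m * l ^+ 2) = expR (8 / d%:R * l ^+ 2) ^+ n.
      by rewrite -expRM_natl; congr expR; rewrite /m; ring.
    rewrite (eq_bigr (fun s' => expR (2 * l * (#|agreement s s'|%:R - m)))); last first.
      by move=> s' _; rewrite mulrA.
    rewrite S -exprMn lerXn2r ?nnegrE ?mulr_ge0 ?expR_ge0 ?ler0n//.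
      have : 1 <= d%:R :> R by rewrite ler1n.
    by have := expR_ge0 (2 * l); lra.
    (* [l <= 1/4] allows the quadratic bound at [2 l]. The linear term cancels against the centring
       factor, leaving [8 l^2 / d] per coordinate. *)
    have q : expR (2 * l) <= 1 + 2 * l + 2 * (2 * l) ^+ 2 by apply: expR_le_quadratic; lra.
    rewrite mulNr expRN mulrC ler_pdivrMr ?expR_gt0// -[leRHS]mulrA -expRD.
    set w := (_ + _ in leRHS).
    have -> : w = (2 * l + 8 * l ^+ 2) / d%:R by rewrite /w; ring.
    apply: (@le_trans _ _ (d%:R * (1 + (2 * l + 8 * l ^+ 2) / d%:R))); last first.
      by rewrite ler_wpM2l ?expR_ge1Dx// ltW.
    by rewrite mulrDr mulr1 mulrCA divff ?gt_eqF// mulr1; lra.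
  have -> : \sum_s' A s' = (1 + e) * d%:R ^+ n
     + (\sum_s' expR (2 * u s') - 2 * \sum_s' expR (u s') + d%:R ^+ n) / (4 * e).
    rewrite -c [in RHS]mulr_sumr mulr_sumr -sumrB -big_split /= mulr_suml -big_split /=.
    by apply: eq_bigr => s' _; rewrite /A expRM_natl mulr1; ring.
  rewrite [leRHS]mulrDr [d%:R ^+ n * (1 + e)]mulrC lerD2l mulrA.
  apply: ler_wpM2r; first by rewrite invr_ge0 mulr_ge0 // ltW.
  by rewrite mulrBr mulr1; lra.
(* On [J] the sum is grouped by the value of [S]; [inord] is faithful because [S <= n]. *)
rewrite (partition_big (fun s' => inord #|agreement s s'| : 'I_n.+1) xpredT) //=.
have -> : d%:R ^+ n * (2 * y) = 2 * y * d%:R ^+ n by rewrite mulrC.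
apply: (@le_trans _ _ (\sum_(j < n.+1 | (0 < j)%N) y ^+ j * d%:R ^+ n)); last first.
  by rewrite -mulr_suml ler_wpM2r ?exprn_ge0 ?ler0n// sum_geometric_le.
rewrite [leRHS]big_mkcond /=; apply: ler_sum => j _.
have jn : (j <= n)%N by rewrite -ltnS.
have [Jj|nJ] := boolP (J j); last first.
  rewrite big_pred0; first by case: ifP => // _; rewrite mulr_ge0 ?exprn_ge0 ?ler0n.
  move=> s'; apply/negbTE; apply: contra nJ => /andP[Js' /eqP <-].
  by rewrite inordK // ltnS.
have [j0 Fj] := FB j jn Jj; rewrite j0.
apply: (@le_trans _ _ (F j * #|[set s' | #|agreement s s'| == j]%SET|%:R)).
  rewrite mulr_natr -sumr_const le_eqVlt; apply/orP; left; apply/eqP.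
  have E s' : J #|agreement s s'| && (inord #|agreement s s'| == j)
      = (#|agreement s s'| == j :> nat).
    rewrite -val_eqE /= inordK ?ltnS//.
    by have [->|] := eqVneq #|agreement s s'| (j : nat); rewrite ?Jj ?andbF.
  apply: eq_big => [s'|s']; first by rewrite E inE.
  by rewrite E => /eqP ->.
apply: le_trans (ler_wpM2l (F0 j jn) (card_agreement_le R n d j s d0 j0 n0)) _.
by rewrite mulrCA [leRHS]mulrC ler_wpM2l // exprn_ge0 // ler0n.
Qed.

(** * Bounds on the pair weight and the non-asymptotic lower bound *)

Lemma exprB_le (R : realType) (k : nat) (x y z : R) :
  0 <= y -> y <= x -> x <= z -> x ^+ k - y ^+ k <= k%:R * z ^+ k.-1 * (x - y).
Proof.
move=> y0 yx xz; have x0 := le_trans y0 yx; have z0 := le_trans x0 xz.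
rewrite subrXX mulrC ler_wpM2r ?subr_ge0//.
rewrite mulr_natl -[X in _ *+ X](card_ord k) -sumr_const; apply: ler_sum => i _.
have -> : z ^+ k.-1 = z ^+ (k.-1 - i) * z ^+ i.
  by rewrite -exprD subnK //; case: k i => [[]|k i] //=; rewrite -ltnS.
apply: ler_pM; rewrite ?exprn_ge0 ?lerXn2r ?nnegrE//.
exact: le_trans xz.
Qed.

(** With [c = q / (N - q)], [w = 1 + c v - (1 - v) c / (N - 1)]; the subtracted quotient
    [c / (N - 1)] lies in [[0, 1]] because [N - q >= 1]. *)
Lemma affine_weight_bounds (R : realType) (N q v : R) :
  1 < N -> 0 <= q -> q <= N - 1 -> 0 <= v -> v <= 1 ->
  let w := 1 + q * N / ((N - q) * (N - 1)) * (v - N^-1) in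
  0 <= w /\ w <= 1 + q / (N - q) * v.
Proof.
move=> N1 q0 qN v0 v1 w.
have c0 : 0 <= q / (N - q) by rewrite divr_ge0 //; lra.
have c1 : q / (N - q) / (N - 1) <= 1.
  rewrite ler_pdivrMr ?mul1r; last lra.
  by rewrite ler_pdivrMr; [nra|lra].
have -> : w = 1 + q / (N - q) * v - (1 - v) * (q / (N - q) / (N - 1)).
  by rewrite /w; field; rewrite !gt_eqF//; lra.
have c2 : 0 <= q / (N - q) / (N - 1) by rewrite divr_ge0 //; lra.
move: c0 c1 c2; set c := q / (N - q); set b := c / _ => c0 c1 c2.
by split; nra.
Qed.

(** Since [1/N = x0^k], the exponent is controlled by [x^k - x0^k]: nonpositive for [x <= x0], at
    most linear in [x - x0] beyond. The factor [2] bounds [N / (N - 1)]. *)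
Lemma affine_weight_le_expR (R : realType) (k t : nat) (N q v x x0 z T c : R) :
  0 <= x -> 0 <= x0 -> N^-1 = x0 ^+ k -> v <= x ^+ k -> x <= z -> t%:R <= T -> 2 <= N ->
  0 <= q -> q <= N - 1 -> q / (N - q) <= c ->
  0 <= 1 + q * N / ((N - q) * (N - 1)) * (v - N^-1) ->
  (1 + q * N / ((N - q) * (N - 1)) * (v - N^-1)) ^+ t
    <= expR (Num.max 0 (2 * c * T * k%:R * z ^+ k.-1 * (x - x0))).
Proof.
move=> xp x0p NE vx xz tT N2 q0 qN qc w0.
have C0 : 0 <= q * N / ((N - q) * (N - 1)) by rewrite divr_ge0 ?mulr_ge0 //; lra.
have Cc : q * N / ((N - q) * (N - 1)) <= 2 * c.
  have -> : q * N / ((N - q) * (N - 1)) = q / (N - q) * (N / (N - 1)).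
    by field; rewrite !gt_eqF//; lra.
  rewrite mulrC; apply: ler_pM => //; try by rewrite divr_ge0 //; lra.
  by rewrite ler_pdivrMr; lra.
move: w0 C0 Cc; set C := _ / (_ * _) => w0 C0 Cc.
apply: (@le_trans _ _ (expR (C * (v - N^-1)) ^+ t)).
  by rewrite lerXn2r ?nnegrE ?expR_ge0 ?expR_ge1Dx.
rewrite -expRM_natl ler_expR le_max NE.
have t0 : 0 <= t%:R :> R by [].
have [xx|xx] := leP x x0.
  apply/orP; left; apply: mulr_ge0_le0 => //; apply: mulr_ge0_le0 => //.
  by rewrite subr_le0 (le_trans vx)// lerXn2r ?nnegrE.
apply/orP; right.
have vv : v - x0 ^+ k <= k%:R * z ^+ k.-1 * (x - x0).
  by apply: le_trans (exprB_le R k x x0 z x0p (ltW xx) xz); rewrite lerD2r.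
have z0 : 0 <= k%:R * z ^+ k.-1 * (x - x0).
  by rewrite !mulr_ge0 ?exprn_ge0 ?subr_ge0 ?(ltW xx)// (le_trans _ xz).
have -> : 2 * c * T * k%:R * z ^+ k.-1 * (x - x0) = T * (2 * c * (k%:R * z ^+ k.-1 * (x - x0))).
  by ring.
apply: (@le_trans _ _ (t%:R * (2 * c * (k%:R * z ^+ k.-1 * (x - x0))))).
  rewrite ler_wpM2l //; apply: (@le_trans _ _ (C * (k%:R * z ^+ k.-1 * (x - x0)))).
    by rewrite ler_wpM2l.
  by rewrite ler_wpM2r.
by rewrite ler_wpM2r // mulr_ge0 // (le_trans C0).
Qed.

(* [z = d^(eta-1)] separates the two ranges of [S/n]; [y] bounds the ratio of the
   geometric series, its two terms covering [S/n <= s0] and [S/n > s0]. *)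
Section LowerBound.
Context {R : realType} (k : nat) (alpha r p eta s0 : R) (n : nat).
Let d := rb_d alpha n.
Let D : R := ln d%:R.
Let a : R := - ln (1 - p).
Let c : R := p / (1 - p).
Let z : R := expR ((eta - 1) * D).
Let l : R := 2 * c * r * D * k%:R * z ^+ k.-1.
Let y : R := expR (1 - eta / 2 * D) + expR (1 - (1 - a * r) * D) / s0.

Lemma rb_prob_sat_lower (e : R) :
  (2 <= k)%N -> (k <= n)%N -> (1 < d)%N -> 0 < r -> 0 < p -> p < 1 ->
  a * r < 1 ->
  (forall u, 0 <= u -> u <= a -> u <= k%:R * (1 - expR (- u))) ->
  0 < eta -> 0 < s0 -> s0 <= 1 -> c * r * s0 <= eta / 2 ->
  l <= 4^-1 -> y <= 2^-1 -> 0 < e ->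
  1 - (e + (expR (8 * (n%:R / d%:R) * l ^+ 2) - 1) / (4 * e) + 2 * y)
    <= rb_prob_sat k alpha r p n.
Proof.
move=> k2 kn d1 r0 p0 p1 ar1 H eta0 s00 s01 cs l4 y2 e0.
have k0 : (0 < k)%N by rewrite ltnW.
have n0 : (0 < n)%N by exact: leq_trans kn.
have n0r : 0 < n%:R :> R by rewrite ltr0n.
have d0 : (0 < d)%N by rewrite ltnW.
have d0r : 0 < d%:R :> R by rewrite ltr0n.
have d1r : 1 < d%:R :> R by rewrite ltr1n.
have D0 : 0 < D by rewrite ln_gt0.
have dE : d%:R = expR D by rewrite lnK // posrE.
pose N : R := d%:R ^+ k; pose q := rb_q k alpha p n; pose t := rb_t alpha r n.
have NE : N = (d ^ k)%:R by rewrite natrX.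
have N2 : 2 <= N by rewrite NE ler_nat (leq_trans d1)// -{1}(expn1 d) leq_exp2l.
have qp : q%:R <= p * N by rewrite truncn_le mulr_ge0 ?exprn_ge0 // ltW.
have qN : (q < d ^ k)%N.
  by rewrite -(ltr_nat R) -NE; apply: le_lt_trans qp _; rewrite gtr_pMl//; lra.
have qN1 : q%:R <= N - 1.
  by rewrite lerBrDr NE natr1 ler_nat.
have tT : t%:R <= r * n%:R * D by rewrite truncn_le !mulr_ge0 // ltW.
have c0 : 0 < c by rewrite divr_gt0 // subr_gt0.
have q1p : q%:R / (N - q%:R) <= c.
  rewrite ler_pdivrMr; last lra.
  rewrite /c mulrAC ler_pdivlMr ?subr_gt0//; lra.
have a0 : 0 < a by rewrite /a oppr_gt0 ln_lt0 // subr_gt0 p1 /=; lra.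
have eaE : expR a = 1 + c.
  rewrite /a expRN lnK ?posrE ?subr_gt0// /c; field; rewrite gt_eqF//; lra.
have kn' : (0 < k <= n)%N by rewrite k0.
apply: le_trans (rb_prob_sat_ge k alpha r p n kn' d1 qN).
set m : R := n%:R / d%:R.
set B : R := e + _ + 2 * y.
have y0 : 0 <= y by rewrite /y addr_ge0 ?expR_ge0 // divr_ge0 ?expR_ge0 // ltW.
have l0 : 0 <= l.
  by rewrite /l mulr_ge0 ?exprn_ge0 ?expR_ge0 // mulr_ge0 // mulr_ge0 ?(ltW D0) //
    mulr_ge0 ?(ltW r0) // mulr_ge0 // ltW.
(* The bound is uniform in [s], so the outer sum only contributes the second factor [d^n]. *)
suff h (s : rb_assignment alpha n) :
    \sum_(s' : rb_assignment alpha n) pair_weight k alpha p n #|agreement s s'| ^+ t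
      <= d%:R ^+ n * (1 + B).
  have : (\sum_(s : rb_assignment alpha n) \sum_(s' : rb_assignment alpha n)
      pair_weight k alpha p n #|agreement s s'| ^+ t) / (d%:R ^+ n) ^+ 2 <= 1 + B.
    rewrite ler_pdivrMr ?exprn_gt0//.
    apply: (@le_trans _ _ (\sum_(s : rb_assignment alpha n) d%:R ^+ n * (1 + B))).
      by apply: ler_sum => s _.
    rewrite sumr_const card_ffun !card_ord -[leLHS]mulr_natr natrX -/d.
    by rewrite le_eqVlt; apply/orP; left; apply/eqP; ring.
  by lra.
have vP j : (j <= n)%N -> let v : R := (j ^_ k)%:R / (n ^_ k)%:R in
    [/\ 0 <= v, v <= 1, v <= (j%:R / n%:R) ^+ k, 0 <= pair_weight k alpha p n j
      & pair_weight k alpha p n j <= 1 + c * (j%:R / n%:R) ^+ k].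
  move=> jn v; have nk0 : 0 < (n ^_ k)%:R :> R by rewrite ltr0n ffact_gt0.
  have v0 : 0 <= v by rewrite divr_ge0.
  have v1 : v <= 1 by rewrite ler_pdivrMr // mul1r ler_nat leq_ffact2r.
  have vx : v <= (j%:R / n%:R) ^+ k.
    rewrite ler_pdivrMr // expr_div_n mulrAC ler_pdivlMr ?exprn_gt0//.
    by rewrite -!natrX -!natrM ler_nat [X in (_ <= X)%N]mulnC ffact_ratio_le.
  have N1 : 1 < N by lra.
  have [w0 w1] := affine_weight_bounds R N q%:R v N1 (ler0n R q) qN1 v0 v1.
  split=> //; apply: le_trans w1 _; rewrite lerD2l.
  by apply: ler_pM => //; rewrite divr_ge0 //; lra.
have -> : 1 + B = 1 + e + (expR (8 * m * l ^+ 2) - 1) / (4 * e) + 2 * y by rewrite /B; ring.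
apply: (sum_agreement_le R n d s (fun j => pair_weight k alpha p n j ^+ t)
  (fun j => z < j%:R / n%:R) l y e) => //.
- move=> j jn; rewrite -leNgt => jz; have [v0 v1 vx w0 _] := vP j jn.
  have -> : l * (j%:R - n%:R / d%:R) =
      2 * c * (r * n%:R * D) * k%:R * z ^+ k.-1 * (j%:R / n%:R - d%:R^-1).
    by rewrite /l; field; rewrite !gt_eqF.
  apply: (affine_weight_le_expR R k t N q%:R _ (j%:R / n%:R) d%:R^-1 z) => //.
  by rewrite exprVn.
- move=> j jn zj; have [v0 v1 vx w0 w1] := vP j jn.
  have j0 : (0 < j)%N.
    by rewrite lt0n; apply: contraTneq zj => ->; rewrite mul0r -leNgt expR_ge0.
  split => //.
  have j0r : 0 < j%:R :> R by rewrite ltr0n.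
  set x := j%:R / n%:R in zj vx w1 *.
  have x0 : 0 < x by rewrite divr_gt0.
  have x1 : x <= 1 by rewrite ler_pdivrMr // mul1r ler_nat.
  have jE : j%:R = x * n%:R by rewrite /x divfK // gt_eqF.
  have wt : pair_weight k alpha p n j ^+ t <= (1 + c * x ^+ k) ^+ t.
    by rewrite lerXn2r ?nnegrE // (le_trans w0).
  have fE : expR 1 * (n%:R / d%:R) / j%:R = expR (1 - D) / x.
    by rewrite expRD expRN -dE jE; field; rewrite !gt_eqF.
  rewrite fE.
  have f0 : 0 <= expR (1 - D) / x by rewrite divr_ge0 ?expR_ge0 // ltW.
  (* Both subranges reduce to a weight bound [e^(b j)], so that only the ratio per unit of [j] has
     to be compared with [y]. *)
  have key b : pair_weight k alpha p n j ^+ t <= expR b ^+ j ->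
      expR b * (expR (1 - D) / x) <= y ->
      pair_weight k alpha p n j ^+ t * (expR (1 - D) / x) ^+ j <= y ^+ j.
    move=> h1 h2; apply: (@le_trans _ _ ((expR b * (expR (1 - D) / x)) ^+ j)).
      by rewrite [leRHS]exprMn ler_wpM2r // exprn_ge0.
    by rewrite lerXn2r // nnegrE // mulr_ge0 // expR_ge0.
  have [xs|xs] := leP x s0.
  (* As [k >= 2], [x^(k-1) <= x <= s0], so the weight is at most [d^(eta j / 2)]; with
     [1/x < 1/z = d^(1-eta)] the ratio is at most [e d^(-eta/2)]. *)
  + apply: (key (eta / 2 * D)).
      apply: le_trans wt _; apply: (@le_trans _ _ (expR (c * x ^+ k) ^+ t)).
        by rewrite lerXn2r ?nnegrE ?expR_ge0 ?expR_ge1Dx // addr_ge0 // mulr_ge0 ?exprn_ge0 // ltW.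
      rewrite -!expRM_natl ler_expR.
      apply: (@le_trans _ _ (r * n%:R * D * (c * x ^+ k))).
        by rewrite ler_wpM2r // mulr_ge0 ?exprn_ge0 // ltW.
      have -> : r * n%:R * D * (c * x ^+ k) = j%:R * (c * r * x ^+ k.-1 * D).
        by rewrite jE -{1}(prednK k0) exprS; ring.
      rewrite ler_wpM2l // ler_wpM2r ?(ltW D0)//; apply: le_trans cs.
      have cr0 : 0 <= c * r by rewrite mulr_ge0 // ltW.
      rewrite ler_wpM2l //; apply: le_trans xs.
      rewrite -[leRHS]expr1; apply: ler_wiXn2l => //; first exact: ltW.
      by rewrite -ltnS prednK.
    apply: (@le_trans _ _ (expR (1 - eta / 2 * D))); last first.
      by rewrite /y lerDl divr_ge0 ?expR_ge0 // ltW.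
    rewrite mulrA ler_pdivrMr // -expRD.
    apply: (@le_trans _ _ (expR (1 - eta / 2 * D) * z)); last by rewrite ler_wpM2l ?expR_ge0 // ltW.
    by rewrite /z -expRD le_eqVlt; apply/orP; left; apply/eqP; congr expR; field.
  (* As [1 + c = e^a], [expR_pow_le] bounds the base by [e^(a x)], and [t <= r n D] turns its power
     into [d^(a r j)]. With [1/x < 1/s0] the ratio is at most [e d^(a r - 1) / s0]. *)
  + apply: (key (a * r * D)).
      have hx := expR_pow_le R k a x k0 a0 H (ltW x0) x1.
      move: hx; rewrite eaE [1 + c - 1]addrAC subrr add0r => hx.
      apply: le_trans wt _; apply: (@le_trans _ _ (expR (a * x) ^+ t)).
        by rewrite lerXn2r ?nnegrE ?expR_ge0 // addr_ge0 // mulr_ge0 ?exprn_ge0 // ltW.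
      rewrite -!expRM_natl ler_expR.
      apply: (@le_trans _ _ (r * n%:R * D * (a * x))).
        by rewrite ler_wpM2r // mulr_ge0 // ltW.
      by rewrite jE le_eqVlt; apply/orP; left; apply/eqP; ring.
    apply: (@le_trans _ _ (expR (1 - (1 - a * r) * D) / s0)); last first.
      by rewrite /y lerDr expR_ge0.
    rewrite mulrA -expRD; apply: ler_pM; rewrite ?expR_ge0 ?invr_ge0 ?(ltW x0)//.
      by rewrite le_eqVlt; apply/orP; left; apply/eqP; congr expR; ring.
    by rewrite lef_pV2 ?posrE // ltW.
by move=> j jn; have [_ _ _ w0 _] := vP j jn; rewrite exprn_ge0.
Qed.

End LowerBound.

(** * Auxiliary estimates for the limits *)

Lemma rb_prob_sat_le1 (R : realType) (k : nat) (alpha r p : R) (n : nat) :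
  rb_prob_sat k alpha r p n <= 1.
Proof.
rewrite rb_prob_satE; set A := #|_|; set B := #|_|.
have AB : (A <= B)%N by apply/subset_leq_card/fintype.subsetP => I; rewrite !inE => /andP[].
(* Without valid instances the quotient is [0], by the convention [0^-1 = 0]. *)
have [B0|B0] := posnP B; first by rewrite B0 invr0 mulr0.
by rewrite ler_pdivrMr ?ltr0n// mul1r ler_nat.
Qed.

(** [e^(th D) >= (th D / 3)^3] is cubic in [D] and beats [D^2]; hence the [27] in the threshold. *)
Lemma sqr_expRN_small (R : realType) (C th e : R) : 0 <= C -> 0 < th -> 0 < e ->
  \forall D \near +oo, C * D ^+ 2 * expR (- (th * D)) <= e.
Proof.
move=> C0 th0 e0; near=> D.
have D1 : 1 <= D by near: D; exact: nbhs_pinfty_ge.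
have D0 : 0 < D by lra.
have De : C * 27 / (th ^+ 3 * e) <= D by near: D; apply: nbhs_pinfty_ge; rewrite num_real.
have h : (th * D / 3) ^+ 3 <= expR (th * D).
  have -> : th * D = 3%:R * (th * D / 3) by field.
  rewrite expRM_natl lerXn2r ?nnegrE ?expR_ge0//.
    by rewrite divr_ge0 ?mulr_ge0 // ltW.
  by have := expR_ge1Dx (th * D / 3); lra.
rewrite expRN ler_pdivrMr ?expR_gt0//; apply: le_trans (ler_wpM2l (ltW e0) h).
move: De; rewrite ler_pdivrMr ?mulr_gt0 ?exprn_gt0// => De.
have := ler_wpM2r (sqr_ge0 D) De.
have -> : e * (th * D / 3) ^+ 3 = D * (th ^+ 3 * e) * D ^+ 2 / 27 by field.
by rewrite ler_pdivlMr //; nra.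
Unshelve. all: by end_near.
Qed.

Lemma ln_rb_d_cvgy (R : realType) (alpha : R) : 0 < alpha ->
  ln ((rb_d alpha n)%:R : R) @[n --> \oo] --> +oo.
Proof.
move=> al0; apply/cvgryPge => A; near=> n.
(* The added [1] absorbs the truncation in [d > n^alpha - 1]. *)
pose B : R := expR A + 1.
have B0 : 0 < B by rewrite addr_gt0 ?expR_gt0.
have nB : B `^ alpha^-1 <= n%:R by near: n; exact: nbhs_infty_ger.
have nB' : B <= n%:R `^ alpha.
  have -> : B = (B `^ alpha^-1) `^ alpha by rewrite -powRrM mulVf ?powRr1 ?gt_eqF// ltW.
  apply: ge0_ler_powR nB; rewrite ?nnegrE ?powR_ge0//.
  exact: ltW.
have dB : expR A <= (rb_d alpha n)%:R.
  have : n%:R `^ alpha < (rb_d alpha n)%:R + 1 by rewrite natr1 truncnS_gt.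
  by move: nB'; rewrite /B; lra.
by rewrite -[A]expRK ler_ln ?posrE ?expR_gt0// (lt_le_trans _ dB) ?expR_gt0.
Unshelve. all: by end_near.
Qed.

(** Truncation gives [n^alpha < d + 1 <= 2 d], that is [n <= (2 d)^(1/alpha)]. *)
Lemma natr_le_expR_ln_rb_d (R : realType) (alpha : R) (n : nat) :
  0 < alpha -> (0 < n)%N -> (0 < rb_d alpha n)%N ->
  n%:R <= expR ((ln 2 + ln (rb_d alpha n)%:R) / alpha) :> R.
Proof.
move=> al0 n0 d0; have n0r : 0 < n%:R :> R by rewrite ltr0n.
have d1r : 1 <= (rb_d alpha n)%:R :> R by rewrite ler1n.
rewrite -[leLHS]lnK ?posrE// ler_expR ler_pdivlMr // mulrC -ln_powR -lnM ?posrE //; last lra.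
rewrite ler_ln ?posrE ?powR_gt0 ?mulr_gt0//; last lra.
have : n%:R `^ alpha < (rb_d alpha n)%:R + 1 by rewrite natr1 truncnS_gt.
by lra.
Qed.

(** * The two limits *)

Lemma rb_unsat (R : realType) (k : nat) (alpha r p : R) :
  (2 <= k)%N -> 0 < alpha -> 0 < r -> 0 < p -> p < 1 -> 1 - expR (- r^-1) < p ->
  rb_prob_sat k alpha r p n @[n --> \oo] --> (0 : R).
Proof.
move=> k2 al0 r0 p0 p1 pcr.
(* A midpoint: above [1 - p], to absorb the truncation of [q], and below [e^(-1/r)], so that
   [1 + r ln p' = - K] is still negative. *)
pose p' := (1 - p + expR (- r^-1)) / 2.
have pp' : 1 - p < p' by rewrite /p'; lra.
have p'e : p' < expR (- r^-1) by rewrite /p'; lra.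
have p'0 : 0 < p' by lra.
have e1 : expR (- r^-1) < 1 by rewrite -expR0 ltr_expR oppr_lt0 invr_gt0.
have lp : ln p' < - r^-1 by rewrite -[ltRHS]expRK ltr_ln ?posrE ?expR_gt0.
have lp0 : ln p' < 0 by apply: lt_trans lp _; rewrite oppr_lt0 invr_gt0.
pose K := - (1 + r * ln p').
have K0 : 0 < K.
  have : r * ln p' < r * - r^-1 by rewrite ltr_pM2l.
  by rewrite mulrN divff ?gt_eqF // /K; lra.
have DA A : \forall n \near \oo, A <= ln (rb_d alpha n)%:R :> R.
  by move/cvgryPge : (ln_rb_d_cvgy R alpha al0); apply.
apply/cvgrPdist_le => e e0; near=> n.
have D1 : 1 <= ln (rb_d alpha n)%:R :> R by near: n; apply: DA.
(* [- ln p'] pays for the truncation [t > r n D - 1], which costs at most a factor [1/p']. *)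
have De : (- ln p' - ln e) / K <= ln (rb_d alpha n)%:R by near: n; apply: DA.
have Dp : - ln (p' - (1 - p)) <= ln (rb_d alpha n)%:R by near: n; apply: DA.
have kn : (k <= n)%N by near: n; exact: nbhs_infty_ge.
pose d := rb_d alpha n; pose D : R := ln d%:R.
rewrite -/d -/D in D1 De Dp.
have n1 : 1 <= n%:R :> R by rewrite ler1n (leq_trans _ kn) // ltnW.
(* [ln 0] is [0] by convention, so [1 <= D] excludes [d = 0]. *)
have d0 : (0 < d)%N.
  by rewrite lt0n; apply: contraTneq D1 => d0; rewrite /D d0 ln0 // -ltNge.
have d0r : 0 < d%:R :> R by rewrite ltr0n.
have dE : d%:R = expR D by rewrite lnK // posrE.
pose N : R := d%:R ^+ k.
have dN : d%:R <= N.
  by rewrite -[leLHS]expr1 /N ler_weXn2l ?ler1n // ltnW.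
have N0 : 0 < N by exact: lt_le_trans dN.
pose q := rb_q k alpha p n; pose t := rb_t alpha r n.
have qp : q%:R <= p * N by rewrite truncn_le mulr_ge0 // ltW.
have qp' : p * N < q%:R + 1 by rewrite natr1 truncnS_gt.
have qN : (q <= d ^ k)%N by rewrite -(ler_nat R) natrX; apply: le_trans qp _;
  rewrite -/N ger_pMl // ltW.
have tT : r * n%:R * D < t%:R + 1 by rewrite natr1 truncnS_gt.
have w1 : 1 - q%:R / N <= p'.
  have : N^-1 <= p' - (1 - p).
    rewrite -[leRHS]invrK lef_pV2 ?posrE ?invr_gt0 ?subr_gt0//; apply: le_trans dN.
    rewrite dE -[leLHS]lnK ?posrE ?invr_gt0 ?subr_gt0// ler_expR lnV ?posrE ?subr_gt0//.
  have : p - N^-1 <= q%:R / N.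
    by rewrite ler_pdivlMr // mulrBl mulVf ?gt_eqF//; lra.
  by lra.
have w0 : 0 <= 1 - q%:R / N by rewrite subr_ge0 ler_pdivrMr // mul1r /N -natrX ler_nat.
have P0 : 0 <= rb_prob_sat k alpha r p n by rewrite divr_ge0.
rewrite sub0r normrN ger0_norm //.
apply: le_trans (rb_prob_sat_le k alpha r p n kn d0 qN) _.
rewrite -/d -/q -/t -/N.
apply: (@le_trans _ _ (expR D ^+ n * p' ^+ t)).
  by rewrite dE ler_wpM2l ?exprn_ge0 ?expR_ge0 // lerXn2r ?nnegrE // ltW.
rewrite -(lnK p'0) -!expRM_natl -expRD -[leRHS](lnK e0) ler_expR.
move: De; rewrite ler_pdivrMr // => De.
have : t%:R * ln p' <= (r * n%:R * D - 1) * ln p'.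
  by rewrite ler_nM2r //; lra.
have -> : (r * n%:R * D - 1) * ln p' = n%:R * D * (- K - 1) - ln p' by rewrite /K; ring.
have D0 : 0 <= D by exact: le_trans D1.
have : 0 <= (n%:R - 1) * (D * K) by rewrite mulr_ge0 ?subr_ge0 // mulr_ge0 // ltW.
have -> : (n%:R - 1) * (D * K) = n%:R * D * K - D * K by ring.
have -> : n%:R * D * (- K - 1) = - (n%:R * D * K) - n%:R * D by ring.
clear -De; move: (n%:R * D * K) (n%:R * D) (D * K) (t%:R * ln p') De => a b c h.
by lra.
Unshelve. all: by end_near.
Qed.

Lemma rb_sat (R : realType) (k : nat) (alpha r p : R) :
  (2 <= k)%N -> 0 < alpha -> 0 < r -> 0 < p -> p < 1 ->
  1 < (2 * k - 1)%:R * alpha ->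
  r^-1 <= k%:R * (1 - expR (- r^-1)) ->
  p < 1 - expR (- r^-1) ->
  rb_prob_sat k alpha r p n @[n --> \oo] --> (1 : R).
Proof.
move=> k2 al0 r0 p0 p1 ka kr pcr.
pose a := - ln (1 - p); pose c := p / (1 - p).
have q0 : 0 < 1 - p by lra.
have ar1 : a * r < 1.
  rewrite -ltr_pdivlMr // div1r /a ltrNl -[ltLHS]expRK ltr_ln ?posrE ?expR_gt0//; lra.
have ar : a <= r^-1 by rewrite -div1r ler_pdivlMr // ltW.
(* Below the threshold [a < 1/r], and concavity carries the hypothesis from [1/r] down to all of
   [[0, a]]. *)
have H u : 0 <= u -> u <= a -> u <= k%:R * (1 - expR (- u)).
  move=> u0 ua; apply: (le_mulr_1subexpRN R r^-1) => //; first by rewrite invr_gt0.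
  exact: le_trans ar.
have c0 : 0 < c by rewrite divr_gt0.
have kr2 : 2 <= k%:R :> R by rewrite ler_nat.
have k1E : (k.-1)%:R = k%:R - 1 :> R by rewrite -subn1 natrB // ltnW.
have k2E : (2 * k - 1)%:R = 2 * k%:R - 1 :> R.
  by rewrite natrB ?natrM // muln_gt0 /= (ltnW k2).
(* The slack in [(2k-1) alpha > 1]. Taking [eta = delta / (4 k)] spends at most half of it below,
   and [eta <= 1/2] makes [l] at most of order [D d^(-1/2)]. *)
pose delta := 2 * k%:R - 1 - alpha^-1.
have delta0 : 0 < delta.
  by move: ka; rewrite k2E -ltr_pdivrMr // div1r subr_gt0.
have ai0 : 0 < alpha^-1 by rewrite invr_gt0.
pose eta := delta / (4 * k%:R).
have eta0 : 0 < eta by rewrite divr_gt0 // mulr_gt0 //; lra.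
have etak : eta * k%:R = delta / 4 by rewrite /eta; field; rewrite gt_eqF //; lra.
have eta1 : eta <= 2^-1.
  by rewrite /eta ler_pdivrMr; [rewrite /delta; lra|lra].
pose s0 := Num.min 1 (eta / (2 * c * r)).
have cr0 : 0 < 2 * c * r by rewrite mulr_gt0 // mulr_gt0.
have s00 : 0 < s0 by rewrite lt_min ltr01 divr_gt0.
have s01 : s0 <= 1 by rewrite ge_min lexx.
have cs : c * r * s0 <= eta / 2.
  have : s0 <= eta / (2 * c * r) by rewrite ge_min lexx orbT.
  by rewrite ler_pdivlMr // => h; lra.
have DT (P : R -> Prop) : (\forall D \near +oo, P D) ->
    \forall n \near \oo, P (ln (rb_d alpha n)%:R).
  by move=> h; exact: (ln_rb_d_cvgy R alpha al0) _ h.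
(* Decay exponent: [n <= (2 d)^(1/alpha)] gives [(n/d) l^2] of order at most [D^2 d^(-th)]. *)
pose th := 1 + 2 * (1 - eta) * (k%:R - 1) - alpha^-1.
have th0 : 0 < th.
  have -> : th = delta / 2 + 2 * eta by rewrite /th /delta; move: etak; rewrite /delta; lra.
  by lra.
pose C0 := 2 * c * r * k%:R.
have C00 : 0 < C0 by rewrite mulr_gt0 //; lra.
apply/cvgrPdist_le => e e0.
(* Three error terms receive [e4] each: [g] solves [(expR g - 1) / (4 e4) = e4], and [y2 <= e4 / 2]
   because [y] enters doubled. *)
pose e4 := e / 4; have e40 : 0 < e4 by rewrite divr_gt0.
pose g := ln (1 + 4 * e4 ^+ 2).
have g0 : 0 < g by rewrite ln_gt0 // ltrDl mulr_gt0 // exprn_gt0.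
pose y2 := Num.min 2^-1 (e4 / 2).
have y20 : 0 < y2 by rewrite lt_min invr_gt0 ltr0n divr_gt0.
have y2h : 0 < y2 / 2 by rewrite divr_gt0.
have eta20 : 0 < eta / 2 by rewrite divr_gt0.
have ar0 : 0 < 1 - a * r by rewrite subr_gt0.
have e1s0 : 0 <= expR 1 / s0 by rewrite divr_ge0 ?expR_ge0 // ltW.
have G0 : 0 <= 8 * expR (ln 2 / alpha) * C0 ^+ 2.
  by rewrite mulr_ge0 ?sqr_ge0 // mulr_ge0 ?expR_ge0.
have V1 := DT (fun D => 1 <= D) (nbhs_pinfty_ge (num_real 1)).
have T1' : \forall n \near \oo,
    C0 * ln (rb_d alpha n)%:R ^+ 2 * expR (- (2^-1 * ln (rb_d alpha n)%:R)) <= 4^-1.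
  apply: (DT (fun D => C0 * D ^+ 2 * expR (- (2^-1 * D)) <= 4^-1)).
  by apply: sqr_expRN_small => //; exact: ltW.
have T2' : \forall n \near \oo,
    8 * expR (ln 2 / alpha) * C0 ^+ 2 * ln (rb_d alpha n)%:R ^+ 2
      * expR (- (th * ln (rb_d alpha n)%:R)) <= g.
  apply: (DT (fun D => 8 * expR (ln 2 / alpha) * C0 ^+ 2 * D ^+ 2 * expR (- (th * D)) <= g)).
  exact: sqr_expRN_small.
have T3' : \forall n \near \oo,
    expR 1 * ln (rb_d alpha n)%:R ^+ 2 * expR (- (eta / 2 * ln (rb_d alpha n)%:R)) <= y2 / 2.
  apply: (DT (fun D => expR 1 * D ^+ 2 * expR (- (eta / 2 * D)) <= y2 / 2)).
  by apply: sqr_expRN_small => //; exact: expR_ge0.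
have T4' : \forall n \near \oo,
    expR 1 / s0 * ln (rb_d alpha n)%:R ^+ 2
      * expR (- ((1 - a * r) * ln (rb_d alpha n)%:R)) <= y2 / 2.
  apply: (DT (fun D => expR 1 / s0 * D ^+ 2 * expR (- ((1 - a * r) * D)) <= y2 / 2)).
  exact: sqr_expRN_small.
near=> n.
have kn : (k <= n)%N by near: n; exact: nbhs_infty_ge.
have D1 : 1 <= ln (rb_d alpha n)%:R :> R by near: n.
have T1 : C0 * ln (rb_d alpha n)%:R ^+ 2 * expR (- (2^-1 * ln (rb_d alpha n)%:R)) <= 4^-1
  by near: n.
have T2 : 8 * expR (ln 2 / alpha) * C0 ^+ 2 * ln (rb_d alpha n)%:R ^+ 2
    * expR (- (th * ln (rb_d alpha n)%:R)) <= g
  by near: n.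
have T3 : expR 1 * ln (rb_d alpha n)%:R ^+ 2 * expR (- (eta / 2 * ln (rb_d alpha n)%:R)) <= y2 / 2
  by near: n.
have T4 : expR 1 / s0 * ln (rb_d alpha n)%:R ^+ 2
    * expR (- ((1 - a * r) * ln (rb_d alpha n)%:R)) <= y2 / 2
  by near: n.
rewrite ger0_norm ?subr_ge0 ?rb_prob_sat_le1//.
have D0 : 0 < ln (rb_d alpha n)%:R :> R by exact: lt_le_trans D1.
have d1 : (1 < rb_d alpha n)%N.
  rewrite ltnNge; apply/negP => d1; move: D0; rewrite ltNge => /negP; apply.
  by apply: ln_le0; rewrite -[leRHS]/(1%:R) ler_nat.
have n0 : (0 < n)%N by apply: leq_trans kn; rewrite ltnW.
have nle := natr_le_expR_ln_rb_d R alpha n al0 n0 (ltnW d1).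
have low := rb_prob_sat_lower k alpha r p eta s0 n e4 k2 kn d1 r0 p0 p1 ar1 H eta0 s00 s01 cs.
have d0 : 0 < (rb_d alpha n)%:R :> R by rewrite ltr0n ltnW.
have dE : (rb_d alpha n)%:R = expR (ln (rb_d alpha n)%:R) :> R by rewrite lnK // posrE.
rewrite -/c -/a in low; move: low.
set D := ln _ in D1 T1 T2 T3 T4 D0 nle dE *.
have DD : 1 <= D ^+ 2 by rewrite exprn_ege1.
have DD' : D <= D ^+ 2 by rewrite expr2 ler_peMl // ltW.
set l := 2 * c * r * D * _ * _; set y := expR _ + _ / s0.
have lE : l = C0 * D * expR (- ((1 - eta) * (k%:R - 1) * D)).
  rewrite /l -expRM_natl k1E /C0.
  have -> : (k%:R - 1) * ((eta - 1) * D) = - ((1 - eta) * (k%:R - 1) * D) by ring.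
  by ring.
have l4 : l <= 4^-1.
  apply: le_trans T1; rewrite lE; apply: ler_pM; first by rewrite mulr_ge0 // ltW.
  - exact: expR_ge0.
  - by apply: ler_wpM2l => //; exact: ltW.
  rewrite ler_expR lerN2; apply: ler_wpM2r; first exact: ltW.
  have : 0 <= (2^-1 - eta) * (k%:R - 1) by rewrite mulr_ge0 //; lra.
  by lra.
have y2le : y <= y2.
  have h1 : expR (1 - eta / 2 * D) <= y2 / 2.
    apply: le_trans T3; rewrite expRD ler_wpM2r ?expR_ge0//.
    by rewrite ler_peMr ?expR_ge0.
  have h2 : expR (1 - (1 - a * r) * D) / s0 <= y2 / 2.
    apply: le_trans T4; rewrite expRD mulrAC ler_wpM2r ?expR_ge0//.
    by rewrite ler_peMr.
  by rewrite /y; lra.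
have y20' : y2 <= 2^-1 by rewrite ge_min lexx.
have y2e : y2 <= e4 / 2 by rewrite ge_min lexx orbT.
move=> /(_ l4 (le_trans y2le y20') e40).
have m8 : 8 * (n%:R / (rb_d alpha n)%:R) * l ^+ 2 <= g.
  apply: le_trans T2.
  have -> : 8 * expR (ln 2 / alpha) * C0 ^+ 2 * D ^+ 2 * expR (- (th * D))
      = 8 * (expR ((ln 2 + D) / alpha) / expR D) * l ^+ 2.
    rewrite lE !exprMn -[expR (- (_ * D)) ^+ 2]expRM_natl -expRN.
    have -> : expR ((ln 2 + D) / alpha) = expR (ln 2 / alpha) * expR (D / alpha).
      by rewrite mulrDl expRD.
    have -> : - (th * D) = D / alpha + (- D) + 2 * - ((1 - eta) * (k%:R - 1) * D).
      by rewrite /th; ring.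
    by rewrite !expRD; ring.
  by rewrite ler_wpM2r ?sqr_ge0 // ler_wpM2l // dE; exact: ler_wpM2r.
have : (expR (8 * (n%:R / (rb_d alpha n)%:R) * l ^+ 2) - 1) / (4 * e4) <= e4.
  rewrite ler_pdivrMr ?mulr_gt0// lerBlDl.
  have -> : 1 + e4 * (4 * e4) = expR g.
    by rewrite /g lnK ?posrE ?addr_gt0 ?mulr_gt0 ?exprn_gt0//; ring.
  by rewrite ler_expR.
have ee : e = e4 * 4 by rewrite /e4 divfK.
rewrite ee; move: e40 y2le y2e; clear.
move: (_ / (4 * e4)) (rb_prob_sat _ _ _ _ _) => u v; lra.
Unshelve. all: by end_near.
Qed.

Theorem theorem3p2 (R : realType) (k : nat) (alpha r p : R) :
  (2 <= k)%N -> 0 < alpha -> 0 < r -> 0 < p -> p < 1 ->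
  1 < (2 * k - 1)%:R * alpha ->
  expR r^-1 * ln (expR r^-1) / (expR r^-1 - 1) <= k%:R ->
  (p < 1 - (expR r^-1)^-1 ->
     rb_prob_sat k alpha r p n @[n --> \oo] --> (1 : R)) /\
  (1 - (expR r^-1)^-1 < p ->
     rb_prob_sat k alpha r p n @[n --> \oo] --> (0 : R)).
Proof.
move=> k2 al0 r0 p0 p1 ka kr; rewrite -expRN; split => pcr; last exact: rb_unsat.
apply: rb_sat => //; have ri0 : 0 < r^-1 by rewrite invr_gt0.
have e1 : 0 < expR r^-1 - 1 by rewrite subr_gt0 -expR0 ltr_expR.
(* Since [ln tau = 1/r], dividing the hypothesis by [tau] yields [1/r <= k (1 - e^(-1/r))]. *)
move: kr; rewrite expRK ler_pdivrMr // => kr.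
rewrite -(ler_pM2l (expR_gt0 r^-1)) mulrCA mulrBr mulr1 expRN mulfV //.
by rewrite gt_eqF ?expR_gt0.
Qed.
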